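(* Let $F=\{f_1<\cdots<f_k\}$ be a finite set of positive integers. Then the polynomials $H_n^F$, $n\in\sigma_F$, are common eigenfunctions of the second order differential operator $$D_F=-\partial^2+h_1(x)\,\partial+h_0(x),$$ where $\partial=d/dx$ and $$h_1(x)=2\left(x+\frac{\Omega_F'(x)}{\Omega_F(x)}\right),\qquad h_0(x)=2\left(k+u_F-x\frac{\Omega_F'(x)}{\Omega_F(x)}\right)-\frac{\Omega_F''(x)}{\Omega_F(x)}.$$ More precisely, $D_F(H_n^F)=2n\,H_n^F$ for all $n\in\sigma_F$.
   Context: Hermite polynomials: $H_n(x)=n!\sum_{j=0}^{[n/2]}\frac{(-1)^j(2x)^{n-2j}}{j!(n-2j)!}$ (physicists' normalization, orthogonal with respect to $e^{-x^2}$). For $F=\{f_1<\cdots<f_k\}$ put $u_F=\sum_{f\in F}f-\binom{k+1}{2}$ and $\sigma_F=\{u_F,u_F+1,u_F+2,\dots\}\setminus\{u_F+f: f\in F\}$. For $n\in\sigma_F$, $H_n^F(x)$ is the $(k+1)\times(k+1)$ determinant whose first row is $(H_{n-u_F}^{(j)}(x))_{j=0}^k$ and whose $(i+1)$-th row is $(H_{f_i}^{(j)}(x))_{j=0}^k$, $i=1,\dots,k$. Also $\Omega_F(x)=\det\big(H_{f_i}^{(j-1)}(x)\big)_{i,j=1}^k$ (a non-zero polynomial). The eigenvalue equations are identities of rational functions. *)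

(* Defs.v *)
From HB Require Import structures.
From mathcomp Require Import all_boot all_order all_algebra.

Set Implicit Arguments.
Unset Strict Implicit.
Unset Printing Implicit Defensive.

Import GRing.Theory Num.Theory.
Local Open Scope ring_scope.

Notation "p %:F" := (@FracField.tofrac _ p) : ring_scope.

(* Throughout, a finite set F = {f_1 < ... < f_k} of positive integers is the
   strictly increasing sequence of its elements, so f_i is nth 0 F i.-1 and
   k = size F. *)
Definition finite_posint_set (F : seq nat) : bool :=
  sorted ltn F && all (leq 1) F.

(* The subtraction is the usual one on such an F: see uF_exact. *)
Definition uF (F : seq nat) : nat :=
  (\sum_(f <- F) f - 'C((size F).+1, 2))%N.

Definition sigmaF (F : seq nat) : pred nat :=
  [pred n | (uF F <= n)%N && (n \notin [seq (uF F + f)%N | f <- F])].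

Lemma uF_exact (F : seq nat) : finite_posint_set F ->
  (uF F + 'C((size F).+1, 2) = \sum_(f <- F) f)%N.
Proof.
case/andP=> srtF posF; rewrite /uF subnK //.
have Fi i : (i < size F)%N -> (i < nth 0 F i)%N.
  elim: i => [|i IHi] ltiF; first exact: (all_nthP 0%N posF).
  apply: leq_ltn_trans (IHi (ltnW ltiF)) _.
  by rewrite (sorted_ltn_nth ltn_trans 0%N srtF) ?inE // ltnW.
rewrite (big_nth 0%N) -bin2_sum big_nat_recl // add0n.
by rewrite big_nat [leqRHS]big_nat; apply: leq_sum => i /andP[_ /Fi].
Qed.

Section HermiteWronskians.
Variable R : numFieldType.

Definition hermite (n : nat) : {poly R} :=
  n`!%:R *: \sum_(j < n./2.+1)
    ((-1) ^+ j / (j`! * (n - j.*2)`!)%:R) *: (2 *: 'X) ^+ (n - j.*2).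

Definition OmegaF (F : seq nat) : {poly R} :=
  \det (\matrix_(i < size F, j < size F) (hermite (nth 0%N F i))^`(j)).

(* Row 0 is built from H_{n - u_F} and row i, for 0 < i, from H_{f_i}. *)
Definition hermiteF (F : seq nat) (n : nat) : {poly R} :=
  \det (\matrix_(i < (size F).+1, j < (size F).+1)
          (hermite (nth 0%N (n - uF F :: F)%N i))^`(j)).

(* OmegaF F is nonzero for F as above (distinct degrees, characteristic 0), so
   the quotients below are genuine rational functions. *)
Definition h1F (F : seq nat) : {fraction {poly R}} :=
  2 * ('X%:F + (OmegaF F)^`()%:F / (OmegaF F)%:F).

Definition h0F (F : seq nat) : {fraction {poly R}} :=
  2 * ((size F + uF F)%:R - 'X%:F * ((OmegaF F)^`()%:F / (OmegaF F)%:F))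
  - (OmegaF F)^`(2)%:F / (OmegaF F)%:F.

(* The operator D_F on polynomials, with values in the rational functions. *)
Definition DF (F : seq nat) (p : {poly R}) : {fraction {poly R}} :=
  - p^`(2)%:F + h1F F * p^`()%:F + h0F F * p%:F.

End HermiteWronskians.

(* Main.v *)
Require Import Defs.
From mathcomp Require Import all_boot all_order all_algebra.
From mathcomp Require Import ring zify.
Import GRing.Theory Num.Theory.
Local Open Scope ring_scope.

(* Let [c_j] be the vector of the [j]-th derivatives of the [k+1] Hermite
   polynomials, [e] the first basis vector and [L] the diagonal matrix of the
   indices, so that [c_(j+2) = 2 x c_(j+1) + 2 j c_j - 2 L c_j] and [L e = m e],
   with [m = n - u_F].  Writing [[a b]] for [det(c_0, ..., c_(k-2), a, b)], one has
   [W = [c_(k-1) c_k]] for [W = H_n^F] and, up to sign, [Omega = [c_(k-1) e]].  The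
   eigenvalue equation times [Omega] is bilinear in the derivatives of [W] and
   [Omega], which are again brackets, except for
   [det(c_0, ..., c_(k-3), c_(k-1), c_k, e)] in [Omega''].  That term is eliminated by
   letting [L] act on the columns of [W] and [Omega] one at a time, which
   multiplies a determinant by [tr L]; two Pluecker relations cancel the rest.
   The determinants are nonzero because their top coefficient is, up to the
   leading coefficients, the Vandermonde determinant of the degrees. *)

(** * Determinants as functions of their rows *)

Section RowDeterminant.
Context {S : comNzRingType} {N : nat}.
Implicit Types (v : nat -> 'rV[S]_N) (w : 'rV[S]_N).

(** Rows are indexed by [nat], so that shifting an index needs no ordinal arithmetic; rows from [N]
    on are ignored. *)
Definition detrows v : S := \det (\matrix_(j < N) v j).

Definition setrow v (p : nat) w : nat -> 'rV[S]_N :=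
  fun j => if j == p then w else v j.

Lemma eq_detrows {v1 v2} :
  (forall j, (j < N)%N -> v1 j = v2 j) -> detrows v1 = detrows v2.
Proof.
by move=> eqv; congr (\det _); apply/row_matrixP=> j; rewrite !rowK eqv.
Qed.

Lemma detrows_dup v p q :
  (p < N)%N -> (q < N)%N -> p != q -> v p = v q -> detrows v = 0.
Proof.
move=> ltp ltq neq eqv.
apply: (@determinant_alternate _ _ _ (Ordinal ltp) (Ordinal ltq)) => // i.
by rewrite !mxE /= eqv.
Qed.

(** Laplace expansion along row [p], whose cofactors do not see that row; linearity in the row
    follows at once. *)
Lemma detrows_setrowE v (p : 'I_N) w :
  detrows (setrow v p w) = (w *m \adj (\matrix_(j < N) v j)) 0 p.
Proof.
rewrite /detrows (expand_det_row _ p) mxE; apply: eq_bigr => i _.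
rewrite !mxE /setrow eqxx; congr (_ * _); rewrite /cofactor; congr (_ * \det _).
by apply/matrixP=> a b; rewrite !mxE /= eq_sym (negPf (neq_bump _ _)).
Qed.

Lemma detrows_lin v p a b w1 w2 : (p < N)%N ->
  detrows (setrow v p (a *: w1 + b *: w2)) =
  a * detrows (setrow v p w1) + b * detrows (setrow v p w2).
Proof.
move=> ltp; rewrite !(detrows_setrowE _ (Ordinal ltp)).
by rewrite mulmxDl -!scalemxAl !mxE.
Qed.

Lemma detrowsZ v p a w : (p < N)%N ->
  detrows (setrow v p (a *: w)) = a * detrows (setrow v p w).
Proof.
by move=> ltp; rewrite !(detrows_setrowE _ (Ordinal ltp)) -!scalemxAl !mxE.
Qed.

Lemma detrows0 v p : (p < N)%N -> detrows (setrow v p 0) = 0.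
Proof. by move=> ltp; rewrite -(scale0r 0) detrowsZ // mul0r. Qed.

Lemma setrowC v p q a b : p != q ->
  setrow (setrow v p a) q b =1 setrow (setrow v q b) p a.
Proof.
by move=> neq j; rewrite /setrow; case: (eqVneq j p) neq => // -> /negPf->.
Qed.

Lemma detrows_swap v p q a b : (p < N)%N -> (q < N)%N -> p != q ->
  detrows (setrow (setrow v p a) q b) = - detrows (setrow (setrow v p b) q a).
Proof.
move=> ltp ltq neq.
have dup x : detrows (setrow (setrow v p x) q x) = 0.
  apply: (detrows_dup _ p q) => //.
  by rewrite /setrow (negPf neq) !eqxx.
have addr1 u i w1 w2 : (i < N)%N -> detrows (setrow u i (w1 + w2)) =
    detrows (setrow u i w1) + detrows (setrow u i w2).
  by move=> lti; rewrite -{1}(scale1r w1) -{1}(scale1r w2) detrows_lin // !mul1r.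
have swap x z : detrows (setrow (setrow v p x) q z) =
    detrows (setrow (setrow v q z) p x).
  by apply: eq_detrows => j _; apply: setrowC.
have := dup (a + b).
rewrite addr1 // !swap !addr1 // -!swap !dup addr0 add0r.
by move=> /eqP; rewrite addrC addr_eq0 => /eqP.
Qed.

(** With [A] the matrix of rows, the sum is the trace of [A *m L *m \adj A]; cyclicity brings
    [\adj A *m A], a scalar matrix, together. *)
Lemma detrows_trace v (L : 'M[S]_N) :
  \sum_(j < N) detrows (setrow v j (v j *m L)) = \tr L * detrows v.
Proof.
pose A := \matrix_(j < N) v j.
transitivity (\tr (A *m L *m \adj A)).
  apply: eq_bigr => j _; rewrite detrows_setrowE -{1}(rowK v j) -/A.
  by rewrite -!row_mul !mxE.
by rewrite -mulmxA mxtrace_mulC -mulmxA mul_adj_mx mul_mx_scalar mxtraceZ mulrC.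
Qed.

(* Cramer's rule expands [c] in the rows; the bracket [ _ e] kills all of them
   except those in positions [p] and [q]. *)
Lemma detrows_plucker v p q a b c e :
  (p < N)%N -> (q < N)%N -> p != q ->
  let B x y := detrows (setrow (setrow v p x) q y) in
  B a b * B c e = B c b * B a e + B a c * B b e.
Proof.
move=> ltp ltq neq B; pose P := Ordinal ltp; pose Q := Ordinal ltq.
pose u := setrow (setrow v p a) q b; pose A := \matrix_(j < N) u j.
have neqPQ : Q != P by rewrite eq_sym.
have cramer : \det A *: c = \sum_j (c *m \adj A) 0 j *: u j.
  rewrite -mul_mx_scalar -mul_adj_mx mulmxA mulmx_sum_row.
  by apply: eq_bigr => j _; rewrite rowK.
pose f w := detrows (setrow (setrow v q e) p w).
have fB w : B w e = f w.
  apply: eq_detrows => j _; rewrite /setrow.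
  by case: (eqVneq j q) => // ->; rewrite eq_sym (negPf neq).
have fsum (g : 'I_N -> S) : f (\sum_j g j *: u j) = \sum_j g j * f (u j).
  rewrite /f !(detrows_setrowE _ P) mulmx_suml summxE; apply: eq_bigr => j _.
  by rewrite (detrows_setrowE _ P) -scalemxAl mxE.
have := congr1 f cramer; rewrite fsum {1}/f detrowsZ // -/(f c) -fB => ->.
rewrite (bigD1 P) //= (bigD1 Q) //= big1 ?addr0 => [|j /andP[jP jQ]]; last first.
  rewrite [f _](@detrows_dup _ p j) ?mulr0 //; first by rewrite eq_sym.
  rewrite /setrow /u eqxx /setrow; have -> : (j == p :> nat) = false by exact: negPf.
  by have -> : (j == q :> nat) = false by exact: negPf.
rewrite -!detrows_setrowE !fB; congr (_ * f _ + _ * f _).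
- apply: eq_detrows => j _; rewrite /u /setrow /=.
  by case: (eqVneq j p) => // ->; rewrite (negPf neq).
- by rewrite /u /setrow /= (negPf neq) eqxx.
- by apply: eq_detrows => j _; rewrite /u /setrow /=; case: eqP.
- by rewrite /u /setrow /= eqxx.
Qed.

End RowDeterminant.

(** * Derivatives of products and determinants *)

Section PolyWronskian.
Variable R : comNzRingType.

Lemma deriv_prod (I : finType) (F : I -> {poly R}) :
  (\prod_i F i)^`() = \sum_i \prod_j (if j == i then (F j)^`() else F j).
Proof.
(* The test [j == i] singles out one factor only if the list has no repetition. *)
suff H (s : seq I) : uniq s -> (\prod_(i <- s) F i)^`() =
    \sum_(i <- s) \prod_(j <- s) (if j == i then (F j)^`() else F j).
  by rewrite H ?index_enum_uniq.
elim: s => [|i s IHs] /= => [_|/andP[nsi us]]; first by rewrite !big_nil derivC.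
rewrite !big_cons derivM IHs // eqxx mulr_sumr; congr (_ * _ + _).
  rewrite [LHS]big_seq [RHS]big_seq; apply: eq_bigr => j sj.
  by case: eqP sj nsi => // -> ->.
rewrite [LHS]big_seq [RHS]big_seq; apply: eq_bigr => j sj.
by rewrite big_cons; case: eqP sj nsi => // -> ->.
Qed.

Lemma deriv_detrows N (v : nat -> 'rV[{poly R}]_N) :
  (detrows v)^`() =
  \sum_(p < N) detrows (setrow v p (map_mx (@deriv R) (v p))).
Proof.
rewrite /detrows /determinant raddf_sum exchange_big /=; apply: eq_bigr => s _.
rewrite -mulr_sumr derivM -(rmorph_sign (@polyC R)) derivC mul0r add0r deriv_prod.
congr (_ * _); apply: eq_bigr => p _; apply: eq_bigr => j _.
by rewrite !mxE /setrow -val_eqE /=; case: eqP => // ->; rewrite mxE.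
Qed.

End PolyWronskian.

(** * The bilinear identity for Wronskians of solutions of Hermite-type equations *)

Section DarbouxCrum.
Variables (R : comNzRingType) (y : nat -> {poly R}) (l : nat -> R).
Hypothesis ode : forall i,
  (y i)^`(2) = 2 * 'X * (y i)^`() - 2 * (l i)%:P * y i.

Let dN k : (k%:R : {poly R})^`() = 0.
Proof. by rewrite -polyC_natr derivC. Qed.

Let dC (a : R) : (a%:P)^`() = 0.
Proof. exact: derivC. Qed.

Lemma ode_derivn i j :
  (y i)^`(j.+2) = 2 * 'X * (y i)^`(j.+1) + 2 * j%:R * (y i)^`(j)
                  - 2 * (l i)%:P * (y i)^`(j).
Proof.
elim: j => [|j IHj]; first by rewrite ode derivn0 derivn1; ring.
rewrite derivnS IHj derivB derivD !derivM !dN !derivX !derivC -!derivnS -[j.+1%:R]natr1 IHj.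
by ring.
Qed.

(** Transposing makes the order of differentiation the row index. *)
Lemma det_derivn_rows N :
  \det (\matrix_(i < N, j < N) (y i)^`(j)) =
  detrows (fun j => \row_(i < N) (y i)^`(j)).
Proof. by rewrite -det_tr; congr (\det _); apply/matrixP=> i j; rewrite !mxE. Qed.

Section Brackets.
Variable r : nat.
(** Three rows are reserved: [B] replaces the last two, [E] also row [r]. *)
Let N := r.+3.
Let c j : 'rV[{poly R}]_N := \row_i (y i)^`(j).
Let e : 'rV[{poly R}]_N := delta_mx 0 0.
Let L : 'M[{poly R}]_N := diag_mx (\row_i (l i)%:P).
Let B a b := detrows (setrow (setrow c r.+1 a) r.+2 b).
(* [E] is the shape taken by the exceptional term of [Omega'']. *)
Let E t a b := detrows (setrow (setrow (setrow c r t) r.+1 a) r.+2 b).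
Let dv : 'rV[{poly R}]_N -> 'rV[{poly R}]_N := map_mx (@deriv R).

Lemma rows_rec j :
  c j.+2 = (2 * 'X) *: c j.+1 + (2 * j%:R) *: c j - 2 *: (c j *m L).
Proof.
apply/rowP=> i; rewrite !mxE (bigD1 i) //= big1 => [|k ki].
  by rewrite !mxE eqxx mulr1n -!derivnS ode_derivn; ring.
by rewrite !mxE (negPf ki) mulr0n mulr0.
Qed.

Lemma dv_rows j : dv (c j) = c j.+1.
Proof. by apply/rowP=> i; rewrite !mxE derivnS. Qed.

(** Only the last three rows contribute: for [p < r], differentiating row [p] produces a copy of row
    [p.+1]. *)
Lemma deriv_bracket a b : (B a b)^`() = E (c r.+1) a b + B (dv a) b + B a (dv b).
Proof.
rewrite deriv_detrows !big_ord_recr /= big1 ?add0r => [|p _]; last first.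
  have ltp := ltn_ord p.
  apply: (@detrows_dup _ _ _ p p.+1); rewrite /N; try lia.
  rewrite /setrow; do ?[case: eqP; try lia].
  by move=> *; apply: dv_rows.
congr (_ + _ + _); apply: eq_detrows => j ltj; rewrite /setrow;
  do ?[case: eqP; try lia]; move=> *; try by [|apply: dv_rows].
Qed.

(** For [p <= r] the recurrence writes [c p *m L] through [c p], [c p.+1] and [c p.+2]: the first
    gives the diagonal sum, the second repeats a row. *)
Lemma bracket_trace w :
  2 * \tr L * B (c r.+1) w =
  (\sum_(p < r.+1) 2 * p%:R) * B (c r.+1) w + E (c r.+1) (c r.+2) w
  + 2 * B (c r.+1 *m L) w + 2 * B (c r.+1) (w *m L).
Proof.
pose v := setrow (setrow c r.+1 (c r.+1)) r.+2 w.
have rowL p : 2 *: (c p *m L) =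
    (2 * 'X) *: c p.+1 + 1 *: ((2 * p%:R) *: c p + (-1) *: c p.+2).
  by rewrite rows_rec scale1r scaleN1r addrA subKr.
have rowD p : (p <= r)%N -> 2 * detrows (setrow v p (v p *m L)) =
    2 * p%:R * B (c r.+1) w - detrows (setrow v p (c p.+2)).
  move=> lep; have ltp : (p < N)%N by rewrite /N; lia.
  have -> : v p = c p by rewrite /v /setrow; do ?[case: eqP; try lia].
  rewrite -detrowsZ // rowL !detrows_lin // (@detrows_dup _ _ _ p p.+1) //; last 3 first.
  - by rewrite /N; lia.
  - by rewrite neq_ltn ltnSn.
  - rewrite /v /setrow; do ?[case: eqP; try lia] => //.
    by move=> *; congr (c _); lia.
  have -> : detrows (setrow v p (c p)) = B (c r.+1) w.
    by apply: eq_detrows => j ltj; rewrite /v /setrow;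
       do ?[case: eqP; try lia] => // *; congr (c _); lia.
  by ring.
have low : \sum_(p < r.+1) 2 * detrows (setrow v p (v p *m L)) =
    (\sum_(p < r.+1) 2 * p%:R) * B (c r.+1) w + E (c r.+1) (c r.+2) w.
  under eq_bigr => p _ do rewrite rowD ?leq_ord //.
  (* For [p < r], [c p.+2] repeats row [p.+2]. For [p = r], exchanging [c r.+2] with [c r.+1]
     absorbs the minus sign. *)
  rewrite sumrB mulr_suml; congr (_ + _); rewrite big_ord_recr big1 /= => [|p _].
    rewrite add0r; pose u := setrow c r.+2 w.
    transitivity (- detrows (setrow (setrow u r (c r.+2)) r.+1 (c r.+1))).
      congr (- _); apply: eq_detrows => j _; rewrite /v /u /setrow;
      do ?[case: eqP; try lia] => // *; congr (c _); lia.
    rewrite detrows_swap ?opprK /N; try lia.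
    apply: eq_detrows => j _; rewrite /u /setrow;
    do ?[case: eqP; try lia] => // *; congr (c _); lia.
  have ltp := ltn_ord p.
  apply: (@detrows_dup _ _ _ p p.+2); rewrite /N; try lia.
  rewrite /v /setrow; do ?[case: eqP; try lia] => // *; congr (c _); lia.
rewrite -mulrA -[X in _ * (_ * X)]/(detrows v) -detrows_trace.
rewrite [in LHS]big_ord_recr [in LHS]big_ord_recr /= !mulrDr mulr_sumr low; congr (_ + _ * _ + _ * _);
  apply: eq_detrows => j ltj; rewrite /v /setrow;
  do ?[case: eqP; try lia] => // *; congr (c _); lia.
Qed.

Lemma bracket_eq0 a : B a a = 0.
Proof.
apply: (@detrows_dup _ _ _ r.+1 r.+2); rewrite /N; try lia.
by rewrite /setrow; do ?[case: eqP; try lia].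
Qed.

Lemma dv_delta : dv e = 0.
Proof. by apply/rowP=> i; rewrite !mxE -polyC_natr derivC. Qed.

Lemma delta_eigen : e *m L = (l 0%N)%:P *: e.
Proof.
apply/rowP=> i; rewrite mul_mx_diag !mxE mulrC.
by case: (eqVneq i 0) => [->|_]; rewrite ?andbF ?mulr0.
Qed.

Lemma bracket_bilinear (W := B (c r.+1) (c r.+2)) (O := B (c r.+1) e) :
  - W^`(2) * O + 2 * O^`() * W^`() - O^`(2) * W
  + 2 * 'X * (O * W^`() - O^`() * W) + 2 * (r.+2%:R - (l 0%N)%:P) * W * O = 0.
Proof.
have E0 a b : E a a b = 0.
  apply: (@detrows_dup _ _ _ r r.+1); rewrite /N; try lia.
  by rewrite /setrow; do ?[case: eqP; try lia].
have dW : W^`() = B (c r.+1) (c r.+3).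
  by rewrite deriv_bracket E0 !dv_rows bracket_eq0 !add0r.
have d2W : W^`(2) = B (c r.+2) (c r.+3) + B (c r.+1) (c r.+4).
  by rewrite derivnS derivn1 dW deriv_bracket E0 !dv_rows !add0r.
have B0 a : B a 0 = 0 by rewrite /B detrows0 // /N; lia.
have dO : O^`() = B (c r.+2) e.
  by rewrite deriv_bracket E0 !dv_rows dv_delta B0 addr0 add0r.
have d2O : O^`(2) = E (c r.+1) (c r.+2) e + B (c r.+3) e.
  by rewrite derivnS derivn1 dO deriv_bracket !dv_rows dv_delta B0 addr0.
have Brec a j : B a (c j.+2) =
    2 * 'X * B a (c j.+1) + 2 * j%:R * B a (c j) - 2 * B a (c j *m L).
  have ltN : (r.+2 < N)%N by rewrite /N.
  rewrite rows_rec -scaleNr -addrA -[X in _ *: _ + X]scale1r.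
  rewrite /B !detrows_lin //; ring.
have plucker := @detrows_plucker _ _ c r.+1 r.+2.
have swap x z : B x z = - B z x by apply: detrows_swap; rewrite /N; lia.
have p1 : W * B (c r.+3) e =
    - B (c r.+2) (c r.+3) * O + B (c r.+1) (c r.+3) * B (c r.+2) e.
  by rewrite -swap; apply: plucker; rewrite /N; lia.
have p2 : W * B (c r.+1 *m L) e =
    B (c r.+1 *m L) (c r.+2) * O + B (c r.+1) (c r.+1 *m L) * B (c r.+2) e.
  by apply: plucker; rewrite /N; lia.
have Ebb : E (c r.+1) (c r.+2) (c r.+2) = 0.
  apply: (@detrows_dup _ _ _ r.+1 r.+2); rewrite /N; try lia.
  by rewrite /setrow; do ?[case: eqP; try lia].
have Ble : B (c r.+1) (e *m L) = (l 0%N)%:P * O.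
  by rewrite delta_eigen /B detrowsZ // /N; lia.
have t1 := bracket_trace e; have t2 := bracket_trace (c r.+2).
rewrite Ebb addr0 -/W in t2; rewrite Ble -/O in t1.
(* Multiply [t1] by [W] and [t2] by [O]: both [\tr L] and the sum of the [2 * p%:R] cancel. *)
have EW : E (c r.+1) (c r.+2) e * W =
    2 * (B (c r.+1 *m L) (c r.+2) + B (c r.+1) (c r.+2 *m L)) * O
    - 2 * B (c r.+1 *m L) e * W - 2 * (l 0%N)%:P * O * W.
  transitivity ((2 * \tr L * W) * O - (\sum_(p < r.+1) 2 * p%:R) * O * W
    - 2 * B (c r.+1 *m L) e * W - 2 * (l 0%N)%:P * O * W); last by rewrite t2; ring.
  by rewrite mulrAC t1; ring.
(* The constant [r.+2%:R] of the identity comes from [a4]. *)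
have a3 := Brec (c r.+1) r.+1; have a4 := Brec (c r.+1) r.+2.
rewrite bracket_eq0 -/W in a3; rewrite -/W in a4.
rewrite d2W dO d2O dW (mulrDl (E _ _ _)) EW [B (c r.+3) e * W]mulrC p1 a4.
(* Two vanishing terms remain: the recurrence [a3] times the derivative of [O], and twice the
   Pluecker relation [p2]. *)
transitivity (B (c r.+2) e * (B (c r.+1) (c r.+3) -
  (2 * 'X * W - 2 * B (c r.+1) (c r.+1 *m L))) +
  2 * (W * B (c r.+1 *m L) e -
    (B (c r.+1 *m L) (c r.+2) * O + B (c r.+1) (c r.+1 *m L) * B (c r.+2) e))).
  by rewrite -/W; ring.
by rewrite p2 a3 -/W; ring.
Qed.

End Brackets.

(** The brackets need size at least 3, so [k = 0] and [k = 1] are computed directly. The identity is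
    linear in [O], so the sign relating [O] to its bracket factors out. *)
Lemma wronskian_bilinear k
    (W := \det (\matrix_(i < k.+1, j < k.+1) (y i)^`(j)))
    (O := \det (\matrix_(i < k, j < k) (y i.+1)^`(j))) :
  - W^`(2) * O + 2 * O^`() * W^`() - O^`(2) * W
  + 2 * 'X * (O * W^`() - O^`() * W) + 2 * (k%:R - (l 0%N)%:P) * W * O = 0.
Proof.
rewrite {}/W {}/O; case: k => [|[|r]].
- rewrite det_mx11 det_mx00 mxE /= (ode 0%N : (y 0%N)^`()^`() = _) -polyC1 !derivC.
  by rewrite polyC1; ring.
- have ode2 i : (y i)^`()^`() = _ := ode i.
  have -> : \det (\matrix_(i < 2, j < 2) (y i)^`(j)) =
      y 0%N * (y 1%N)^`() - (y 0%N)^`() * y 1%N.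
    rewrite (expand_det_row _ ord0) !big_ord_recl big_ord0 /cofactor.
    by rewrite !det_mx11 !mxE /= /bump /= !addn0 !add0n expr0 expr1; ring.
  rewrite det_mx11 mxE /=.
  do ?rewrite !(derivD, derivN, derivM, derivX, ode2, dN, dC).
  by ring.
set W := \det _; set O := \det _.
have := bracket_bilinear r; cbv zeta.
pose c := fun j => \row_(i < r.+3) (y i)^`(j).
have <- : W = detrows (setrow (setrow c r.+1 (c r.+1)) r.+2 (c r.+2)).
  rewrite /W det_derivn_rows; apply: eq_detrows => j _; rewrite /setrow.
  by do ?[case: eqP => [->|_]].
(* Expanding along the last row [e] leaves one cofactor, that of column 0, which drops [y 0]. *)
have -> : detrows (setrow (setrow c r.+1 (c r.+1)) r.+2 (delta_mx 0 0))
          = (-1) ^+ r.+2 * O.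
  transitivity (detrows (setrow c (@ord_max r.+2) (delta_mx 0 0))).
    apply: eq_detrows => j _; rewrite /setrow; case: eqP => // _.
    by case: eqP => [->|].
  rewrite detrows_setrowE -rowE !mxE /cofactor addn0; congr (_ * _).
  rewrite -det_tr; congr (\det _); apply/matrixP=> i j; rewrite !mxE /=.
  by rewrite /bump /= leqNgt ltn_ord add0n.
set s := _ ^+ _.
have sE p : (s * p)^`() = s * p^`().
  by rewrite /s -(rmorph_sign (@polyC R)) derivM derivC mul0r add0r.
have sE2 p : (s * p)^`(2) = s * p^`(2) by rewrite derivnS derivn1 !sE.
rewrite sE2 !sE => sH.
apply: (can_inj (signrMK r.+2)); rewrite mulr0 -/s -[RHS]sH.
by ring.
Qed.

End DarbouxCrum.

(** * Wronskians of polynomials of distinct degrees *)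

Section Nonvanishing.
Variable R : numFieldType.

Let falling j : {poly R} := \prod_(l < j) ('X - l%:R%:P).

Lemma horner_falling j d : (falling j).[d%:R] = (d ^_ j)%:R.
Proof.
rewrite horner_prod; elim: j => [|j IHj]; first by rewrite big_ord0.
rewrite big_ord_recr IHj /= hornerXsubC ffactnSr natrM.
have [ltdj|lejd] := ltnP d j; first by rewrite ffact_small // !mul0r.
by rewrite natrB.
Qed.

Lemma size_falling j : size (falling j) = j.+1.
Proof. by rewrite size_prod_XsubC /index_enum -enumT size_enum_ord. Qed.

(** Each [falling j] is monic of degree [j], so the matrix is a Vandermonde matrix times a
    unitriangular one; the nodes stay distinct in characteristic 0. *)
Lemma det_ffact_neq0 N (d : 'I_N -> nat) : injective d ->
  \det (\matrix_(i < N, j < N) (d i ^_ j)%:R : 'M[R]_N) != 0.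
Proof.
move=> injd; pose a : 'rV[R]_N := \row_i (d i)%:R.
pose U : 'M[R]_N := \matrix_(j, l) (falling j)`_l.
have -> : \matrix_(i < N, j < N) (d i ^_ j)%:R = (Vandermonde N a)^T *m U^T.
  apply/matrixP=> i j; rewrite !mxE -horner_falling.
  rewrite (@horner_coef_wide _ N) ?size_falling //.
  by apply: eq_bigr => l _; rewrite !mxE mulrC.
rewrite det_mulmx !det_tr det_Vandermonde (@det_trig _ _ U); last first.
  by apply/is_trig_mxP=> j l ltjl; rewrite mxE nth_default // size_falling.
rewrite mulf_neq0 //; apply/prodf_neq0 => i _.
  apply/prodf_neq0 => j ltij; rewrite !mxE subr_eq0 eqr_nat inj_eq //.
  by rewrite neq_ltn ltij orbT.
rewrite mxE; have := monic_prod_XsubC (index_enum 'I_i) xpredT (fun l => l%:R : R).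
by rewrite monicE lead_coefE -/(falling i) size_falling => /eqP->; apply: oner_neq0.
Qed.

Lemma coef_prod_top (I : Type) (r : seq I) (q : I -> {poly R}) (d : I -> nat) :
  (forall i, (size (q i) <= (d i).+1)%N) ->
  (\prod_(i <- r) q i)`_(\sum_(i <- r) d i) = \prod_(i <- r) (q i)`_(d i).
Proof.
move=> leqd.
(* The size bound joins the induction: it kills the convolution terms of index below [d i]. *)
suff [] : (size (\prod_(i <- r) q i)%R <= (\sum_(i <- r) d i).+1)%N /\
  (\prod_(i <- r) q i)`_(\sum_(i <- r) d i) = \prod_(i <- r) (q i)`_(d i) by [].
elim: r => [|i r [IHs IHc]]; first by rewrite !big_nil size_poly1 coef1.
rewrite !big_cons; split.
  have := size_polyMleq (q i) (\prod_(j <- r) q j); have := leqd i; lia.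
rewrite -IHc coefM.
rewrite (bigD1 (inord (d i))) //= inordK ?ltnS ?leq_addr // addKn [X in _ + X]big1 ?addr0 // => j.
rewrite -val_eqE /= inordK ?ltnS ?leq_addr // => neqj.
have [ltj|gtj] : (j < d i \/ d i < j)%N by lia.
  by rewrite [X in _ * X]nth_default ?mulr0 //; apply: leq_trans IHs _; lia.
by rewrite nth_default ?mul0r //; apply: leq_trans (leqd i) _.
Qed.

Lemma wronskian_neq0 N (p : 'I_N -> {poly R}) (d : 'I_N -> nat) :
  injective d -> (forall i, size (p i) = (d i).+1) ->
  \det (\matrix_(i < N, j < N) (p i)^`(j)) != 0.
Proof.
move=> injd sizep; pose q i j := (p i)^`(j) * 'X^j.
(* Scaling column [j] by ['X^j] puts the top coefficient of every entry of row
   [i] in degree [d i]. *)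
have coefq i j k : (q i j)`_k = (p i)`_k * (k ^_ j)%:R.
  rewrite coefMXn; case: ltnP => [ltkj|lejk]; first by rewrite ffact_small ?mulr0.
  by rewrite coef_derivn subnKC // mulr_natr.
have sizeq i j : (size (q i j) <= (d i).+1)%N.
  apply/leq_sizeP=> k ltk; rewrite coefq nth_default ?mul0r ?sizep //.
suff: (\det (\matrix_(i < N, j < N) q i j))`_(\sum_i d i) != 0.
  have -> : \matrix_(i < N, j < N) q i j =
      \matrix_(i < N, j < N) (p i)^`(j) *m diag_mx (\row_j 'X^j).
    by apply/matrixP=> i j; rewrite mul_mx_diag !mxE.
  by apply: contraNneq; rewrite det_mulmx => ->; rewrite mul0r coef0.
(* Top coefficients multiply in each Leibniz term; entry [(i, j)] gives the leading coefficient of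
   [p i] times [d i ^_ j]. *)
have -> : (\det (\matrix_(i < N, j < N) q i j))`_(\sum_i d i) =
    \det (diag_mx (\row_i (p i)`_(d i)) *m \matrix_(i < N, j < N) (d i ^_ j)%:R).
  rewrite /determinant coef_sum; apply: eq_bigr => s _.
  rewrite -(rmorph_sign (@polyC R)) coefCM; congr (_ * _).
  under eq_bigr do rewrite mxE.
  rewrite coef_prod_top // => *; apply: eq_bigr => i _.
  by rewrite mul_diag_mx !mxE coefq.
rewrite det_mulmx mulf_neq0 ?det_ffact_neq0 // det_diag.
apply/prodf_neq0 => i _; rewrite mxE -[d i]/((d i).+1.-1) -sizep -lead_coefE.
by rewrite lead_coef_eq0 -size_poly_eq0 sizep.
Qed.

End Nonvanishing.

(** * The differential equation and degree of Hermite polynomials *)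

Section Hermite.
Variable R : numFieldType.
Implicit Type n : nat.

(** On these divided powers, differentiation is twice a shift and the Euler operator is diagonal. *)
Let t i : {poly R} := (i`!)%:R^-1 *: (2 *: 'X) ^+ i.

Let fact_neq0 n : n`!%:R != 0 :> R.
Proof. by rewrite pnatr_eq0 -lt0n fact_gt0. Qed.

Lemma hermiteE n :
  hermite R n = n`!%:R *: \sum_(j < n./2.+1) ((-1) ^+ j / j`!%:R) *: t (n - j.*2).
Proof.
congr (_ *: _); apply: eq_bigr => j _; rewrite /t scalerA; congr (_ *: _).
by rewrite natrM invfM mulrA.
Qed.

Lemma deriv_t i : (t i.+1)^`() = 2 *: t i.
Proof.
rewrite /t derivZ deriv_exp derivZ derivX /= -scalerAl mul1r -scaler_nat !scalerA.
by congr (_ *: _); rewrite factS natrM; field; rewrite fact_neq0 nat1r pnatr_eq0.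
Qed.

Lemma deriv_t0 : (t 0)^`() = 0.
Proof. by rewrite /t derivZ expr0 -polyC1 derivC scaler0. Qed.

Lemma mulX_deriv_t i : 'X * (t i)^`() = i%:R *: t i.
Proof.
case: i => [|i]; first by rewrite deriv_t0 mulr0 scale0r.
rewrite deriv_t /t exprS -scalerAl !scalerAr [in RHS]scalerA factS natrM.
rewrite -!scalerAr !scalerA; congr (_ *: _).
by field; rewrite fact_neq0 nat1r pnatr_eq0.
Qed.

(** The Hermite operator sends the [j]-th summand to [g j.+1 - g j], and both ends of the
    telescoping sum vanish. *)
Lemma hermite_ode n : (hermite R n)^`(2) =
  2 * 'X * (hermite R n)^`() - 2 * (n%:R)%:P * hermite R n.
Proof.
pose a j : R := (-1) ^+ j / j`!%:R.
(* The truncated [n - j.*2] would give [t 0] out of range; the value 0 makes the last telescoped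
   term vanish. *)
pose T j := if (j.*2 <= n)%N then t (n - j.*2) else 0.
pose g j := - (4 * j%:R * a j) *: T j.
have aS j : a j = - (j.+1%:R * a j.+1).
  by rewrite /a exprS factS natrM; field; rewrite fact_neq0 nat1r pnatr_eq0.
have d2t j : (j.*2 <= n)%N -> (t (n - j.*2))^`()^`() = 4 *: T j.+1.
  move=> lej; rewrite /T doubleS; case: leqP => [ltn|leSn].
    have [->|->] : (n - j.*2 = 0)%N \/ (n - j.*2 = 1)%N by lia.
      by rewrite deriv_t0 derivC scaler0.
    by rewrite deriv_t derivZ deriv_t0 !scaler0.
  have -> : (n - j.*2 = (n - j.*2.+2).+2)%N by lia.
  by rewrite deriv_t derivZ deriv_t scalerA -natrM.
have step j : (j < n./2.+1)%N -> a j *: ((t (n - j.*2))^`()^`() -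
    2 * 'X * (t (n - j.*2))^`() + 2 * n%:R%:P * t (n - j.*2)) = g j.+1 - g j.
  move=> ltj; have lej : (j.*2 <= n)%N by lia.
  rewrite d2t // -mulrA mulX_deriv_t /g {3}/T lej.
  have -> : 4 * j.+1%:R * a j.+1 = - 4 * a j by rewrite (aS j); ring.
  rewrite -!mul_polyC natrB // -mul2n natrM !rmorphE /=; ring.
suff /eqP : (hermite R n)^`(2) - 2 * 'X * (hermite R n)^`()
    + 2 * (n%:R)%:P * hermite R n = 0.
  by rewrite -addrA addr_eq0 opprD opprK addrC => /eqP.
rewrite hermiteE derivnS derivn1 !derivZ.
rewrite -!scalerAr -scalerBr -scalerDr.
rewrite !(raddf_sum (@deriv R)) /= !mulr_sumr -sumrB -big_split /=.
rewrite (eq_bigr (fun j : 'I__ => g j.+1 - g j)) => [|j _]; last first.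
  by rewrite -step // !derivZ -!scalerAr -scalerBr -scalerDr.
rewrite -(big_mkord xpredT (fun j => g j.+1 - g j)) telescope_sumr //.
rewrite /g mulr0 mul0r oppr0 scale0r subr0 /T.
by rewrite ifN ?scaler0 //; lia.
Qed.

(** Only the summand [j = 0] reaches degree [n], with coefficient [2 ^+ n]. *)
Lemma size_hermite n : size (hermite R n) = n.+1.
Proof.
have coefh k : (n <= k)%N -> (hermite R n)`_k = if k == n then 2 ^+ n else 0.
  move=> lenk; rewrite hermiteE coefZ coef_sum big_ord_recl big1 => [|j _].
    rewrite /t !coefZ exprZn coefZ coefXn subn0 addr0 expr0 fact0 divr1 mul1r.
    case: eqP => _; rewrite ?mulr0 // mulr1 mulrA divff ?mul1r //.
  rewrite /t !coefZ exprZn coefZ coefXn /=.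
  have := ltn_ord j; rewrite -[bump 0 j]/(j.+1); case: eqP => [? ltj|_ _]; first by exfalso; lia.
  by rewrite !mulr0.
apply/eqP; rewrite eqn_leq; apply/andP; split.
  by apply/leq_sizeP=> k ltk; rewrite coefh ?(ltnW ltk) // gtn_eqF.
rewrite ltnNge; apply/negP=> /leq_sizeP/(_ n (leqnn n))/eqP.
by rewrite coefh // eqxx expf_eq0 pnatr_eq0 andbF.
Qed.

End Hermite.

(** * From the bilinear identity to the eigenvalue equation *)

Lemma clear_denominator (K : fieldType) (x w w1 w2 o o1 o2 k u n : K) :
  o != 0 ->
  - w2 * o + 2 * o1 * w1 - o2 * w + 2 * x * (o * w1 - o1 * w)
    + 2 * (k - (n - u)) * w * o = 0 ->
  - w2 + 2 * (x + o1 / o) * w1 + (2 * (k + u - x * (o1 / o)) - o2 / o) * w =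
  2 * n * w.
Proof.
move=> o0 bil; apply: (mulIf o0); apply: subr0_eq; rewrite -[RHS]bil.
by field.
Qed.

Theorem theorem5p1 (R : numFieldType) (F : seq nat)
    (hF : finite_posint_set F) (n : nat) (hn : n \in sigmaF F) :
  hermiteF R F n != 0 /\
  DF F (hermiteF R F n) = (2 * n)%:R * (hermiteF R F n)%:F.
Proof.
move: hF hn => /andP[srtF _] /andP[leun nF].
have uniqF : uniq F := sorted_uniq ltn_trans ltnn srtF.
(* This is where [n] avoiding the shifted set matters: all degrees in the Wronskian are distinct. *)
have uniqmF : uniq (n - uF F :: F)%N.
  rewrite /= uniqF andbT; apply: contra nF => mF.
  by apply/mapP; exists (n - uF F)%N; rewrite ?subnKC.
have nz (s : seq nat) : uniq s ->
    \det (\matrix_(i < size s, j < size s) (hermite R (nth 0%N s i))^`(j)) != 0.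
  move=> us; apply: (@wronskian_neq0 _ _ _ (fun i => nth 0%N s i)) => [i j|i].
    by move/eqP; rewrite nth_uniq // => /eqP/val_inj.
  exact: size_hermite.
split; first exact: nz uniqmF.
have O0 : OmegaF R F != 0 := nz F uniqF.
(* Index 0 carries [n - uF F], so dropping it turns the Wronskian into [OmegaF]. *)
pose f i := nth 0%N (n - uF F :: F)%N i.
have := @wronskian_bilinear _ (fun i => hermite R (f i)) (fun i => (f i)%:R)
  (fun i => hermite_ode R (f i)) (size F).
cbv zeta; rewrite -/(hermiteF R F n) -/(OmegaF R F) polyC_natr.
set W := hermiteF R F n; set O := OmegaF R F => /(congr1 (@FracField.tofrac _)).
rewrite /DF /h1F /h0F natrM natrD -/W -/O => bil.
apply: clear_denominator; first by rewrite tofrac_eq0.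
rewrite -natrB //; move: bil.
by rewrite !(rmorphD, rmorphB, rmorphN, rmorphM, rmorph_nat, rmorph1, rmorph0).
Qed.
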